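(* Let $r\geqslant 1$ be an integer. Then there exists a unique sequence of Laurent polynomials $\{b_i^{(r)}(q)\}_{i=0}^\infty$ in $q$ with nonnegative integral coefficients such that, for every integer $n\geqslant 0$, $$ \sum_{k=0}^n q^{-rkn}{n\brack k}^r{n+k\brack k}^r=\sum_{i=0}^n q^{-ni}{n\brack i}{n+i\brack i}b_i^{(r)}(q). $$ Moreover, $b_i^{(r)}(q)=\sum_{k=0}^i P_{k,i}^{(r)}(q)$, where the Laurent polynomials $P_{k,i}^{(r)}(q)$ are defined below (with $P_{k,i}^{(r)}(q)=0$ if $i>kr$).
   Context: For integers $n,k$, the $q$-binomial coefficient is ${n\brack k}=\frac{(q)_n}{(q)_k(q)_{n-k}}$ if $0\leqslant k\leqslant n$ and ${n\brack k}=0$ otherwise, where $(q)_0=1$ and $(q)_n=(1-q)(1-q^2)\cdots(1-q^n)$ for $n\geqslant 1$. For integers $k\geqslant 0$ and $r\geqslant 1$, the Laurent polynomials $P_{k,i}^{(r)}(q)$, $k\leqslant i\leqslant rk$, are defined recursively by $P_{k,k}^{(1)}(q)=1$ and, for $0\leqslant j\leqslant rk$, $P_{k,k+j}^{(r+1)}(q)=\sum_{i=k}^{rk}q^{(j-i)(j+k)}{k+i\brack i}{k\brack i-j}{k+j\brack j}P_{k,i}^{(r)}(q)$; they are set to $0$ for $i<k$ or $i>rk$. (Equivalently, they are the unique Laurent polynomials satisfying ${n\brack k}^r{n+k\brack k}^r=\sum_{i=k}^{\min\{n,rk\}} q^{(rk-i)n}{n\brack i}{n+i\brack i}P_{k,i}^{(r)}(q)$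 for all $n\geqslant k$.) *)

(* Defs.v *)
From HB Require Import structures.
From mathcomp Require Import all_boot all_order all_algebra.

Set Implicit Arguments.
Unset Strict Implicit.
Unset Printing Implicit Defensive.

Import GRing.Theory Num.Theory.
Local Open Scope ring_scope.

(* Laurent polynomials in q with integer coefficients are viewed inside the
   field of fractions of Z[q], where the quotient defining the q-binomial
   coefficients and the negative powers of q make sense. *)
Definition Qq : fieldType := {fraction {poly int}}.

Definition q : Qq := tofrac ('X : {poly int}).

Definition nonneg_laurent (x : Qq) : Prop :=
  exists (m : nat) (p : {poly int}),
    (forall i : nat, 0 <= p`_i) /\ x = q ^- m * tofrac p.

Definition qfact (n : nat) : Qq := \prod_(1 <= i < n.+1) (1 - q ^+ i).

(* The arguments are integers: the lower index i - j in the recursion for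
   lauP may be negative, and the coefficient then vanishes. *)
Definition qbin (n k : int) : Qq :=
  if (0 <= k) && (k <= n)
  then qfact `|n|%N / (qfact `|k|%N * qfact `|n - k|%N)
  else 0.

(* lauP r k i is P_{k,i}^{(r)}(q) for r >= 1; the value at r = 0 is junk.
   In the recursive case the superscript is r'.+1, and i = k + j. *)
Fixpoint lauP (r k i : nat) {struct r} : Qq :=
  match r with
  | 0 => 0
  | r'.+1 =>
    if r' == 0%N then (if i == k then 1 else 0)
    else if (k <= i <= r'.+1 * k)%N then
      let j := (i - k)%N in
      \sum_(k <= l < (r' * k).+1)
        q ^ ((j%:Z - l%:Z) * (j%:Z + k%:Z))
        * qbin (k%:Z + l%:Z) l%:Z * qbin k%:Z (l%:Z - j%:Z)
        * qbin (k%:Z + j%:Z) j%:Z * lauP r' k l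
    else 0
  end.

(* Main.v *)
(** Put [B_k(n) = q^(-nk) [n,k] [n+k,k]] and [t_k = q^(k+1) + q^(-k)].  Then
    [(1 - q^(k+1))^2 B_(k+1)(n) = (t_n - t_k) B_k(n)], so the [B_k] are
    Newton-type basis polynomials in the variable [t_n], with a linearization
    [B_k B_l = sum_j c_(k,l,j) B_(k+j)] whose coefficients do not depend on [n].
    Multiplying by [t_n - t_l] gives a recurrence in [l] which the coefficients
    of the recursion for [P] satisfy; hence [B_k^r = sum_i P_(k,i) B_i], and
    summing over [k] gives existence.  Nonnegativity is inherited from the
    q-binomials, and uniqueness holds because [B_i(n)] is triangular with
    nonzero diagonal. *)
Require Import Defs.
From mathcomp Require Import all_boot all_order all_algebra.
From mathcomp Require Import zify ring.
From Stdlib Require Import FunctionalExtensionality.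
Import GRing.Theory Num.Theory.
Local Open Scope ring_scope.

(** * The variable [q] and closure properties of nonnegative Laurent polynomials *)

Lemma q_neq0 : q != 0.
Proof. by rewrite /q tofrac_eq0 polyX_eq0. Qed.

Lemma q_exp_neq1 (n : nat) : 1 - q ^+ n.+1 != 0.
Proof.
rewrite /q -tofracXn -tofrac1 -tofracB tofrac_eq0 subr_eq0 eq_sym.
apply/eqP => /(congr1 (fun p : {poly int} => size p)).
by rewrite size_polyXn size_poly1.
Qed.

Lemma nonneg_laurent0 : nonneg_laurent 0.
Proof.
exists 0%N, 0; split; first by move=> i; rewrite coef0.
by rewrite tofrac0 mulr0.
Qed.

Lemma nonneg_laurent_qexp (n : nat) : nonneg_laurent (q ^+ n).
Proof.
exists 0%N, 'X^n; split; first by move=> i; rewrite coefXn ler0n.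
by rewrite expr0 invr1 mul1r tofracXn.
Qed.

Lemma nonneg_laurent_qexpN (n : nat) : nonneg_laurent (q ^- n).
Proof.
exists n, 1; split; first by move=> i; rewrite coef1 ler0n.
by rewrite tofrac1 mulr1.
Qed.

Lemma nonneg_laurentM (x y : Qq) :
  nonneg_laurent x -> nonneg_laurent y -> nonneg_laurent (x * y).
Proof.
case=> m [p [p_ge0 ->]] [n [s [s_ge0 ->]]].
exists (m + n)%N, (p * s); split.
  by move=> i; rewrite coefM sumr_ge0 // => j _; rewrite mulr_ge0.
by rewrite tofracM exprD invfM mulrACA.
Qed.

Lemma nonneg_laurentD (x y : Qq) :
  nonneg_laurent x -> nonneg_laurent y -> nonneg_laurent (x + y).
Proof.
case=> m [p [p_ge0 ->]] [n [s [s_ge0 ->]]].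
(* Both summands are brought to the common denominator q^(m+n). *)
exists (m + n)%N, ('X^n * p + 'X^m * s); split.
  by move=> i; rewrite coefD !coefXnM addr_ge0 //; case: ifP.
rewrite tofracD !tofracM !tofracXn exprD invfM mulrDr -/q.
rewrite -[in X in _ = X + _]mulrA mulKf ?expf_neq0 ?q_neq0 //.
by rewrite [_^-1 / _]mulrC -mulrA mulKf ?expf_neq0 ?q_neq0.
Qed.

(* Without this, conversion unfolds arithmetic in the fraction field; for the
   same reason the identities below are proved after generalizing over [Qq]. *)
#[local] Opaque Qq q.

Lemma nonneg_laurent_sum (a b : nat) (F : nat -> Qq) :
  (forall i, nonneg_laurent (F i)) -> nonneg_laurent (\sum_(a <= i < b) F i).
Proof.
move=> F_ge0; apply: big_ind => //; first exact: nonneg_laurent0.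
exact: nonneg_laurentD.
Qed.

Lemma nonneg_laurent_qexpz (m : int) : nonneg_laurent (q ^ m).
Proof.
by case: m => m; [exact: nonneg_laurent_qexp | exact: nonneg_laurent_qexpN].
Qed.

(** * q-factorials and q-binomials *)

Lemma qfact0 : qfact 0 = 1.
Proof. by rewrite /qfact big_geq. Qed.

Lemma qfactS (n : nat) : qfact n.+1 = qfact n * (1 - q ^+ n.+1).
Proof. by rewrite /qfact big_nat_recr. Qed.

Lemma qfact_neq0 (n : nat) : qfact n != 0.
Proof.
elim: n => [|n IH]; first by rewrite qfact0 oner_eq0.
rewrite qfactS; apply: mulf_neq0; [exact: IH | exact: q_exp_neq1].
Qed.

(* Extending 1/(q)_m by 0 to negative m makes its recurrence hold for every
   integer m, so that identities between q-binomials need no boundary cases. *)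
Definition qfactV (m : int) : Qq := if m is Posz n then (qfact n)^-1 else 0.

Lemma qfactV_rec (m : int) : qfactV m = (1 - q ^ (m + 1)) * qfactV (m + 1).
Proof.
case: m => [n|[|n]].
- have -> : n%:Z + 1 = n.+1%:Z by lia.
  rewrite /= qfactS -exprnP invfM mulrCA.
  by rewrite mulfV ?mulr1 // q_exp_neq1.
(* At m = -1 the factor 1 - q^0 vanishes, in agreement with the value 0 of [qfactV] there. *)
- by rewrite /= expr0z subrr mul0r.
- have -> : Negz n.+1 + 1 = Negz n by lia.
  by rewrite /= mulr0.
Qed.

Lemma qbinE (n : nat) (k : int) :
  qbin n%:Z k = qfact n * qfactV k * qfactV (n%:Z - k).
Proof.
rewrite /qbin; case: k => [k|k]; last by rewrite /= mulr0 mul0r.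
case: (leqP k n) => kn.
- have -> : (0 <= k%:Z) && (k%:Z <= n%:Z) by lia.
  by rewrite subzn //= invfM mulrA.
- have -> : (0 <= k%:Z) && (k%:Z <= n%:Z) = false by lia.
  have -> : n%:Z - k%:Z = Negz (k - n).-1 by lia.
  by rewrite /= mulr0.
Qed.

(** Free of subtraction and division, this form carries nonnegativity through an induction on n,
    which the defining quotient does not. *)
Lemma qbin_pascal (n k : nat) :
  qbin n.+1%:Z k.+1%:Z = qbin n%:Z k%:Z + q ^+ k.+1 * qbin n%:Z k.+1%:Z.
Proof.
rewrite !qbinE qfactS (qfactV_rec k%:Z) (qfactV_rec (n%:Z - k.+1%:Z)).
have -> : n.+1%:Z - k.+1%:Z = n%:Z - k%:Z by lia.
have -> : n%:Z - k.+1%:Z + 1 = n%:Z - k%:Z by lia.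
have -> : k%:Z + 1 = k.+1%:Z by lia.
rewrite (expfzDr _ _ q_neq0) -!exprnP -!exprnN !(exprS q).
have := expf_neq0 k q_neq0.
move: q (q ^+ k) (q ^+ n) (qfact n) (qfactV k.+1) (qfactV (n%:Z - k%:Z)).
by move: Qq => F s u v a b c u0; field.
Qed.

Lemma nonneg_laurent_qbin (n : nat) (k : int) : nonneg_laurent (qbin n%:Z k).
Proof.
case: k => [k|k]; last first.
  by rewrite qbinE /= mulr0 mul0r; exact: nonneg_laurent0.
elim: n k => [|n IH] [|k].
- by rewrite qbinE /= qfact0 invr1 !mulr1; exact: (nonneg_laurent_qexp 0).
- by rewrite qbinE /= mulr0; exact: nonneg_laurent0.
- rewrite qbinE subr0 /= qfact0 invr1 mulr1 mulfV ?qfact_neq0 //.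
  exact: (nonneg_laurent_qexp 0).
- rewrite qbin_pascal; apply: nonneg_laurentD; first exact: IH.
  by apply: nonneg_laurentM; [exact: nonneg_laurent_qexp | exact: IH].
Qed.

(** * The Newton-type basis *)

Definition qnode (k : nat) : Qq := q ^+ k.+1 + q ^- k.

Definition qbasis (n k : nat) : Qq :=
  q ^- (n * k) * qbin n%:Z k%:Z * qbin (n%:Z + k%:Z) k%:Z.

Lemma qbasisE (n k : nat) :
  qbasis n k = q ^- (n * k) * qfact (n + k) * qfactV k%:Z ^+ 2
               * qfactV (n%:Z - k%:Z).
Proof.
rewrite /qbasis -PoszD !qbinE PoszD addrK /=.
have := qfact_neq0 n; have := qfact_neq0 k.
move: (qfact n) (qfact k) (qfact (n + k)) (qfactV _) (q ^- _).
move: Qq => F a b c d e b0 a0.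
by field; rewrite a0 b0.
Qed.

(** The difference of nodes factors as q^(-n) (1 - q^(n-k)) (1 - q^(n+k+1)), which are the factors
    gained in the numerator when k grows by one. *)
Lemma qbasisS (n k : nat) :
  (1 - q ^+ k.+1) ^+ 2 * qbasis n k.+1 = (qnode n - qnode k) * qbasis n k.
Proof.
rewrite !qbasisE addnS qfactS (qfactV_rec k%:Z) (qfactV_rec (n%:Z - k.+1%:Z)).
have -> : n%:Z - k.+1%:Z + 1 = n%:Z - k%:Z by lia.
have -> : k%:Z + 1 = k.+1%:Z by lia.
rewrite mulnS /qnode (expfzDr _ _ q_neq0) -!exprnP -!exprnN.
rewrite -addnS !exprD !(exprS q).
have := expf_neq0 n q_neq0; have := expf_neq0 k q_neq0.
have := expf_neq0 (n * k) q_neq0.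
move: q (qfact _) (qfactV _) (qfactV _) (q ^+ n) (q ^+ k) (q ^+ (n * k)).
by move: Qq => F s A V W a b c c0 b0 a0; field; rewrite a0 b0 c0.
Qed.

Lemma qbasis0 (n : nat) : qbasis n 0 = 1.
Proof.
rewrite qbasisE muln0 addn0 subr0 /= qfact0 expr0 !invr1 expr1n mul1r mulr1.
by rewrite mulfV // qfact_neq0.
Qed.

Lemma qbasis_eq0 (n k : nat) : (n < k)%N -> qbasis n k = 0.
Proof.
move=> nk; rewrite qbasisE.
have -> : n%:Z - k%:Z = Negz (k - n).-1 by lia.
by rewrite /= mulr0.
Qed.

Lemma qbasis_diag_neq0 (n : nat) : qbasis n n != 0.
Proof.
rewrite qbasisE subrr /= qfact0 invr1 mulr1.
by rewrite !mulf_neq0 ?expf_neq0 ?invr_neq0 ?expf_neq0 ?qfact_neq0 // q_neq0.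
Qed.

(** * Linearization of products of basis elements *)

(** The coefficient c_(k,l,j), written exactly as in the recursion for [lauP], so that [lauPSS]
    holds by conversion. *)
Definition qlin (k l j : nat) : Qq :=
  q ^ ((j%:Z - l%:Z) * (j%:Z + k%:Z))
  * qbin (k%:Z + l%:Z) l%:Z * qbin k%:Z (l%:Z - j%:Z)
  * qbin (k%:Z + j%:Z) j%:Z.

Lemma qlinE (k l j : nat) :
  qlin k l j = q ^ ((j%:Z - l%:Z) * (j%:Z + k%:Z)) * qfact (k + l)
    * qfact (k + j) * qfactV k%:Z * qfactV l%:Z * qfactV j%:Z
    * qfactV (l%:Z - j%:Z) * qfactV (k%:Z - l%:Z + j%:Z).
Proof.
rewrite /qlin -!PoszD !qbinE !PoszD !addrK opprB addrA addrAC /=.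
have := qfact_neq0 k; have := qfact_neq0 l; have := qfact_neq0 j.
move: (qfact j) (qfact k) (qfact l) (qfact (k + l)) (qfact (k + j)) (qfactV _) (qfactV _).
by move: (q ^ _); move: Qq => F s a b c d e f g a0 b0 c0; field; rewrite a0 b0 c0.
Qed.

Lemma qlin_eq0 (k l j : nat) : (l < j)%N -> qlin k l j = 0.
Proof.
move=> lj; rewrite qlinE.
have -> : l%:Z - j%:Z = Negz (j - l).-1 by lia.
by rewrite /= mulr0 mul0r.
Qed.

Lemma qlin_base (k j : nat) : qlin k 0 j = (j == 0%N)%:R.
Proof.
case: j => [|j]; last by rewrite qlin_eq0.
rewrite qlinE sub0r oppr0 mul0r expr0z !addn0 subr0 addr0 /= qfact0 invr1.
have := qfact_neq0 k; move: (qfact k).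
by move: Qq => F a a0; field.
Qed.

Lemma qlinS0 (k l : nat) :
  (1 - q ^+ l.+1) ^+ 2 * qlin k l.+1 0 = (qnode k - qnode l) * qlin k l 0.
Proof.
rewrite !qlinE addnS qfactS addn0 !subr0.
rewrite (qfactV_rec l%:Z) (qfactV_rec (k%:Z - l.+1%:Z)).
have -> : k%:Z - l.+1%:Z + 1 = k%:Z - l%:Z by lia.
have -> : l%:Z + 1 = l.+1%:Z by lia.
have -> : (0%:Z - l.+1%:Z) * (0%:Z + k%:Z) = (0%:Z - l%:Z) * (0%:Z + k%:Z) - k%:Z.
  by lia.
rewrite /qnode !(expfzDr _ _ q_neq0) -!exprnP -!exprnN -addnS exprD !(exprS q).
have := expf_neq0 l q_neq0; have := expf_neq0 k q_neq0.
move: q (q ^+ l) (q ^+ k) (q ^ _) (qfact k) (qfact (k + l)).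
move: (qfactV l.+1) (qfactV 0) (qfactV k) (qfactV (k%:Z - l%:Z)).
by move: Qq => F A B C D s v u X E G u0 v0; field; rewrite u0 v0.
Qed.

(** This is what comparing coefficients of B_(k+j+1) in (t_n - t_l) B_k B_l predicts: B_(k+j)
    contributes by being raised one index, B_(k+j+1) by the scalar t_(k+j+1) - t_l. The case without
    a predecessor is [qlinS0]. *)
Lemma qlinSS (k l j : nat) :
  (1 - q ^+ l.+1) ^+ 2 * qlin k l.+1 j.+1
  = (1 - q ^+ (k + j).+1) ^+ 2 * qlin k l j
    + (qnode (k + j).+1 - qnode l) * qlin k l j.+1.
Proof.
rewrite !qlinE !addnS !qfactS.
have -> : l.+1%:Z - j.+1%:Z = l%:Z - j%:Z by lia.
have -> : k%:Z - l.+1%:Z + j.+1%:Z = k%:Z - l%:Z + j%:Z by lia.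
rewrite (qfactV_rec l%:Z) (qfactV_rec j%:Z) (qfactV_rec (l%:Z - j.+1%:Z)).
rewrite (qfactV_rec (k%:Z - l%:Z + j%:Z)).
have -> : k%:Z - l%:Z + j%:Z + 1 = k%:Z - l%:Z + j.+1%:Z by lia.
have -> : l%:Z - j.+1%:Z + 1 = l%:Z - j%:Z by lia.
have -> : l%:Z + 1 = l.+1%:Z by lia.
have -> : j%:Z + 1 = j.+1%:Z by lia.
(* Every exponent becomes (j-l)(j+k) plus a linear term, so only one power with a quadratic exponent
   remains, to be generalized to [X]. *)
have -> : (j.+1%:Z - l.+1%:Z) * (j.+1%:Z + k%:Z)
          = (j%:Z - l%:Z) * (j%:Z + k%:Z) + j%:Z - l%:Z by nia.
have -> : (j.+1%:Z - l%:Z) * (j.+1%:Z + k%:Z)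
          = (j%:Z - l%:Z) * (j%:Z + k%:Z) + j%:Z - l%:Z + j.+1%:Z + k%:Z by nia.
rewrite /qnode; move: (qfactV (l%:Z - j%:Z)) => B.
move: (qfactV (k%:Z - l%:Z + j.+1%:Z)) => C.
rewrite !(expfzDr _ _ q_neq0) -!exprnP -!exprnN.
move: (q ^ _) => X.
rewrite !(exprS q) !exprD.
have := expf_neq0 l q_neq0; have := expf_neq0 k q_neq0.
have := expf_neq0 j q_neq0; have := q_neq0.
move: B C X q (q ^+ j) (q ^+ l) (q ^+ k) (qfact (k + l)) (qfact (k + j)).
move: (qfactV l.+1) (qfactV j.+1) (qfactV k).
move: Qq => F D E G B C X s w v u H I s0 w0 u0 v0.
by field; rewrite s0 u0 v0 w0.
Qed.

Lemma qbasis_mul (n k l : nat) :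
  qbasis n k * qbasis n l = \sum_(0 <= j < l.+1) qlin k l j * qbasis n (k + j).
Proof.
elim: l => [|l IH].
  by rewrite big_nat1 qlin_base qbasis0 addn0 mulr1 mul1r.
(* Multiplying by this nonzero factor turns B_(l+1) into (t_n - t_l) B_l, to which the induction
   hypothesis applies. *)
apply: (mulfI (expf_neq0 2 (q_exp_neq1 l))).
rewrite mulrCA qbasisS mulrCA IH !mulr_sumr.
(* In the term of index j, t_n - t_l is split as (t_n - t_(k+j)) + (t_(k+j) - t_l); the first part
   raises the basis index. The second sum is extended by a zero term at j = l+1. *)
have -> : \sum_(0 <= j < l.+1)
    (qnode n - qnode l) * (qlin k l j * qbasis n (k + j))
  = \sum_(0 <= j < l.+1)
      (1 - q ^+ (k + j).+1) ^+ 2 * qlin k l j * qbasis n (k + j.+1)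
    + \sum_(0 <= j < l.+2) (qnode (k + j) - qnode l) * qlin k l j
      * qbasis n (k + j).
  rewrite [X in _ = _ + X]big_nat_recr //= qlin_eq0 // mulr0 mul0r addr0.
  rewrite -big_split; apply: eq_bigr => j _ /=.
  rewrite addnS [_ ^+ 2 * _ * _]mulrAC qbasisS.
  move: (qnode _) (qnode _) (qnode _) (qbasis _ _) (qlin _ _ _).
  by move: Qq => F x y z b c; ring.
rewrite [X in _ + X = _]big_nat_recl // [RHS]big_nat_recl // addrCA; congr (_ + _).
  by rewrite [RHS]mulrA qlinS0 addn0.
rewrite -big_split; apply: eq_bigr => j _ /=.
by rewrite [RHS]mulrA qlinSS addnS -[LHS]mulrDl.
Qed.

Lemma nonneg_laurent_qlin (k l j : nat) : nonneg_laurent (qlin k l j).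
Proof.
rewrite /qlin -!PoszD; do !apply: nonneg_laurentM; try exact: nonneg_laurent_qbin.
exact: nonneg_laurent_qexpz.
Qed.

(** * The Laurent polynomials P and powers of basis elements *)

Lemma lauP1 (k i : nat) : lauP 1 k i = (i == k)%:R.
Proof. by rewrite /=; case: eqP. Qed.

Lemma lauPSS (r k i : nat) :
  lauP r.+2 k i = if (k <= i <= r.+2 * k)%N then
    \sum_(k <= l < (r.+1 * k).+1) qlin k l (i - k) * lauP r.+1 k l else 0.
Proof. by []. Qed.

Lemma lauP_supp (r k i : nat) :
  ~~ (k <= i < (r.+1 * k).+1)%N -> lauP r.+1 k i = 0.
Proof.
case: r => [|r]; first by rewrite lauP1 mul1n ltnS -eqn_leq eq_sym => /negPf ->.
by rewrite lauPSS ltnS => /negPf ->.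
Qed.

Lemma nonneg_laurent_lauP (r k i : nat) : nonneg_laurent (lauP r k i).
Proof.
elim: r i => [|[|r] IH] i; first exact: nonneg_laurent0.
  rewrite lauP1; case: eqP => _; last exact: nonneg_laurent0.
  exact: (nonneg_laurent_qexp 0).
rewrite lauPSS; case: ifP => _; last exact: nonneg_laurent0.
apply: nonneg_laurent_sum => l; apply: nonneg_laurentM; last exact: IH.
exact: nonneg_laurent_qlin.
Qed.

Lemma sum_nat_supp (V : nmodType) (f : nat -> V) (a b c : nat) :
  (forall i, ~~ (a <= i < b)%N -> f i = 0) -> (b <= c)%N ->
  \sum_(a <= i < b) f i = \sum_(0 <= i < c) f i.
Proof.
move=> f0 bc; rewrite (big_nat_widen _ _ _ _ _ bc) (big_nat_widenl _ _ _ _ _ (leq0n a)).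
by rewrite big_mkcond; apply: eq_bigr => i _ /=; case: ifPn => //; rewrite andbC => /f0.
Qed.

(** Induction on r: multiply the expansion by B_k, linearize each B_k B_l, and collect the
    coefficient of B_(k+j), which is the recursion for P. *)
Lemma qbasis_exp (r n k : nat) :
  qbasis n k ^+ r.+1
  = \sum_(k <= i < (r.+1 * k).+1) lauP r.+1 k i * qbasis n i.
Proof.
elim: r => [|r IH].
  by rewrite mul1n big_nat1 lauP1 eqxx mul1r expr1.
rewrite exprS IH mulr_sumr.
rewrite -[X in _ = \sum_(X <= _ < _) _]add0n [RHS]big_addn subSn ?leq_pmull //.
have -> : (r.+2 * k - k = r.+1 * k)%N by rewrite mulSn addnC addnK.
rewrite [RHS](eq_big_nat _ _ (F2 := fun j => \sum_(k <= l < (r.+1 * k).+1)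
  qlin k l j * lauP r.+1 k l * qbasis n (k + j))); last first.
  move=> j /andP[_ j_le]; rewrite lauPSS leq_addl mulSn addnC leq_add2l -ltnS j_le.
  by rewrite /= addKn mulr_suml.
rewrite [RHS]exchange_big; apply: eq_big_nat => l /andP[_ l_le].
rewrite mulrCA qbasis_mul mulr_sumr.
(* The range of j is made independent of l, since c_(k,l,j) = 0 for j > l. *)
rewrite (sum_nat_supp _ _ _ _ (r.+1 * k).+1 _ l_le).
  by apply: eq_bigr => j _; rewrite mulrCA mulrA.
by move=> j; rewrite leq0n ltnS -ltnNge => lj; rewrite qlin_eq0 // mul0r mulr0.
Qed.

Lemma sum_qbasis_exp (r n : nat) :
  \sum_(0 <= k < n.+1) qbasis n k ^+ r.+1
  = \sum_(0 <= i < n.+1) qbasis n i * \sum_(0 <= k < i.+1) lauP r.+1 k i.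
Proof.
transitivity (\sum_(0 <= k < n.+1) \sum_(0 <= i < n.+1)
                lauP r.+1 k i * qbasis n i).
  apply: eq_bigr => k _; rewrite qbasis_exp.
  (* Neither (r+1)k nor n need dominate: the range is first enlarged to the larger bound by the
     support of P, then cut at n because B_i(n) = 0 for i > n. *)
  rewrite (sum_nat_supp _ _ _ _ _ _ (leq_maxl _ n.+1)); last first.
    by move=> i /lauP_supp ->; rewrite mul0r.
  rewrite -(sum_nat_supp _ _ 0 n.+1) ?leq_maxr //.
  by move=> i; rewrite leq0n -leqNgt => ni; rewrite qbasis_eq0 // mulr0.
rewrite exchange_big; apply: eq_big_nat => i /andP[_ i_le].
rewrite (sum_nat_supp _ _ _ _ _ _ i_le); last first.
  move=> k; rewrite leq0n -leqNgt => ik; apply: lauP_supp.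
  by rewrite leqNgt ik.
by rewrite mulr_sumr; apply: eq_bigr => k _; rewrite mulrC.
Qed.

(** * Uniqueness and conclusion *)

Lemma qbasis_sum_inj (b c : nat -> Qq) :
  (forall n, \sum_(0 <= i < n.+1) qbasis n i * b i
             = \sum_(0 <= i < n.+1) qbasis n i * c i) ->
  forall i, b i = c i.
Proof.
move=> bc i; have [n] := ubnP i; elim: n i => // n IH i i_lt.
(* At n = i the terms of smaller index agree by induction, leaving only the nonzero diagonal
   coefficient B_i(i) to cancel. *)
have := bc i; rewrite !big_nat_recr //=.
rewrite (eq_big_nat _ _ (F2 := fun j => qbasis i j * c j)).
  by move=> /addrI /(mulfI (qbasis_diag_neq0 i)).
by move=> j /andP[_ ji]; rewrite IH // (leq_trans ji).
Qed.

Theorem theorem1p3 (r : nat) (hr : (1 <= r)%N) :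
  let good (b : nat -> Qq) : Prop :=
    (forall i : nat, nonneg_laurent (b i)) /\
    (forall n : nat,
       \sum_(0 <= k < n.+1)
          q ^- (r * k * n) * qbin n%:Z k%:Z ^+ r * qbin (n%:Z + k%:Z) k%:Z ^+ r
       = \sum_(0 <= i < n.+1)
          q ^- (n * i) * qbin n%:Z i%:Z * qbin (n%:Z + i%:Z) i%:Z * b i) in
  (exists! b : nat -> Qq, good b) /\
  (forall b : nat -> Qq, good b ->
     forall i : nat, b i = \sum_(0 <= k < i.+1) lauP r k i).
Proof.
move=> good; case: r hr @good => // r _ good.
pose b0 i := \sum_(0 <= k < i.+1) lauP r.+1 k i.
have powE n : \sum_(0 <= k < n.+1) q ^- (r.+1 * k * n) * qbin n%:Z k%:Z ^+ r.+1
                * qbin (n%:Z + k%:Z) k%:Z ^+ r.+1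
              = \sum_(0 <= i < n.+1) qbasis n i * b0 i.
  rewrite -sum_qbasis_exp; apply: eq_bigr => k _.
  rewrite /qbasis !exprMn; congr (_ * _ * _).
  by rewrite exprVn -exprM; congr (q ^- _); lia.
have good_b0 : good b0.
  split=> [i|n]; last exact: powE.
  by apply: nonneg_laurent_sum => k; exact: nonneg_laurent_lauP.
have uniq_b0 b : good b -> forall i, b i = b0 i.
  case=> _ bE; apply: qbasis_sum_inj => n.
  by rewrite -powE bE.
split=> //; exists b0; split=> // b /uniq_b0 bE.
(* The quantifier [exists!] asks for equality of sequences as functions, not just termwise. *)
by apply: functional_extensionality => i; rewrite bE.
Qed.
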